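(* Let $F$ be a field of characteristic not $2$. On $F[q]$ define an $F$-linear map $\tau:F[q]\to F$, a commutative multiplication $\star$ and a symmetric bilinear form $\omega$ by $$\tau(f)=f(\tfrac12),\qquad f\star g=q\,(\tau(f)g+\tau(g)f),\qquad \omega(f,g)=\tau(f)\tau(g)=(f\star g)(\tfrac12)=\tau(f\star g).$$ Then the algebra $(F[q],\star)$ is medial, and its associator satisfies, for all $f,g,h\in F[q]$, $$[f,g,h]=(q^2-q)\big(\omega(g,h)f-\omega(f,g)h\big)=(q^2-q)\,\tau(g)\begin{vmatrix} f&h\\ \tau(f)&\tau(h)\end{vmatrix}.$$
   Context: A commutative algebra with product $\star$ is medial if $(x\star y)\star(z\star w)=(x\star z)\star(y\star w)$ for all $x,y,z,w$. The associator is $[f,g,h]=(f\star g)\star h-f\star(g\star h)$. On the right-hand sides, juxtaposition is the ordinary product of polynomials. *)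

(* Defs.v *)
From HB Require Import structures.
From mathcomp Require Import all_boot all_order all_algebra.

Set Implicit Arguments.
Unset Strict Implicit.
Unset Printing Implicit Defensive.

Import GRing.Theory.
Local Open Scope ring_scope.

Section Algebras.

Variables (F : fieldType) (A : lmodType F) (op : A -> A -> A).

(* Algebras here need not be associative or unital. *)
Definition commutative_algebra : Prop :=
  [/\ commutative op,
      forall x, linear (op x)
    & forall y, linear (op^~ y)].

Definition medial : Prop :=
  forall x y z w, op (op x y) (op z w) = op (op x z) (op y w).

Definition associator (f g h : A) : A := op (op f g) h - op f (op g h).

Definition symmetric_bilinear_form (b : A -> A -> F) : Prop :=
  [/\ forall x y, b x y = b y x,
      forall x, scalar (b x)
    & forall y, scalar (b^~ y)].

End Algebras.

Section PolyStar.

Variable F : fieldType.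

(* In characteristic 2, 2^-1 is MathComp's total inverse of 0, namely 0. *)
Definition tau (f : {poly F}) : F := f.[2^-1].

Definition star (f g : {poly F}) : {poly F} :=
  'X * (tau f *: g + tau g *: f).

Definition omega (f g : {poly F}) : F := tau f * tau g.

Definition mx22 (R : Type) (a b c d : R) : 'M[R]_2 :=
  \matrix_(i < 2, j < 2)
    if i == 0 then (if j == 0 then a else b)
    else (if j == 0 then c else d).

End PolyStar.

(* Main.v *)
Require Import Defs.
From mathcomp Require Import all_boot all_order all_algebra.
From mathcomp Require Import ring.

Import GRing.Theory.
Local Open Scope ring_scope.

(** The one fact that uses the choice of the evaluation point is that [tau] is
    multiplicative for [star] ([tau_star]): evaluating
    [q (tau f g + tau g f)] at [1/2] gives [1/2 * 2 * tau f * tau g], which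
    needs [2] to be invertible.  Hence in an iterated product each factor
    [tau] of an inner product splits into a product of values of [tau], and
    the whole product becomes a polynomial expression in the arguments and in
    their values under [tau].  For [(x * y) * (z * w)] this expression is
    [q^2] times the sum, over the four arguments, of that argument multiplied
    by the values of the three others; it is symmetric in [x, y, z, w], so
    the algebra is medial.  In the associator [[f, g, h]] the terms in [g]
    cancel, and those in [f] and [h] have coefficients
    [(q^2 - q) tau g tau h] and [- (q^2 - q) tau f tau g]. *)

Section Star.

Variable F : fieldType.
Implicit Types f g h x y z w : {poly F}.

Lemma tau_linear : scalar (@tau F).
Proof. by move=> a f g; rewrite /tau hornerD hornerZ. Qed.

Lemma starC : commutative (@star F).
Proof. by move=> f g; rewrite /star addrC. Qed.

Lemma star_linear f : linear (star f).
Proof.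
move=> a g h.
rewrite /star tau_linear -!mul_polyC polyCD polyCM.
by ring.
Qed.

Lemma omega_linear f : scalar (omega f).
Proof. by move=> a g h; rewrite /omega tau_linear mulrDr mulrCA. Qed.

Hypothesis char_neq2 : 2%N \notin [pchar F].

(** The two summands of a product agree under [tau], and the factor ['X] takes
    the value [1/2] that turns their sum into their common value. *)
Lemma tau_star f g : tau (star f g) = tau f * tau g.
Proof.
have two_neq0 : 2 != 0 :> F by move: char_neq2; rewrite inE /=.
rewrite {1}/tau /star hornerM hornerX hornerD !hornerZ -/(tau f) -/(tau g).
by field.
Qed.

(** Written this way, the product is visibly invariant under every permutation
    of its arguments; mediality is the exchange of [y] and [z]. *)
Lemma star_starE x y z w :
  star (star x y) (star z w)
    = 'X^2 * ((tau y * tau z * tau w) *: x + (tau x * tau z * tau w) *: y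
              + (tau x * tau y * tau w) *: z + (tau x * tau y * tau z) *: w).
Proof.
(* Only the outer product is expanded at first, so that [tau] of the inner
   ones can be split by [tau_star]. *)
rewrite {1}/star !tau_star /star -!mul_polyC !polyCM.
by ring.
Qed.

Lemma star_medial : medial (@star F).
Proof.
move=> x y z w.
rewrite !star_starE -!mul_polyC !polyCM.
by ring.
Qed.

Lemma associator_star f g h :
  associator (@star F) f g h
    = ('X^2 - 'X) * (omega g h *: f - omega f g *: h).
Proof.
rewrite /associator [star (star f g) h]/star [star f (star g h)]/star.
rewrite !tau_star /star /omega -!mul_polyC !polyCM.
by ring.
Qed.

End Star.

Lemma det_mx22 (R : comNzRingType) (a b c d : R) :
  \det (mx22 a b c d) = a * d - b * c.
Proof.
rewrite (expand_det_row _ 0) !big_ord_recl big_ord0 /cofactor !det_mx11 !mxE /=.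
by ring.
Qed.

Theorem lemma2p12 (F : fieldType) (hF : 2%N \notin [pchar F]) :
  [/\ scalar (@tau F),
      commutative_algebra (@star F),
      symmetric_bilinear_form (@omega F),
      forall f g : {poly F},
        omega f g = (star f g).[2^-1] /\ omega f g = tau (star f g)
    & medial (@star F) /\
      forall f g h : {poly F},
        associator (@star F) f g h
          = ('X^2 - 'X) * (omega g h *: f - omega f g *: h) /\
        associator (@star F) f g h
          = ('X^2 - 'X) * (tau g *: \det (mx22 f h (tau f)%:P (tau h)%:P))].
Proof.
have omegaC (f g : {poly F}) : omega f g = omega g f by rewrite /omega mulrC.
split.
- exact: tau_linear.
- split; [exact: starC | exact: star_linear |].
  by move=> g a f h; rewrite /= !(starC _ _ g) star_linear.
- split; [exact: omegaC | exact: omega_linear |].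
  by move=> g a f h; rewrite /= !(omegaC _ g) omega_linear.
- by move=> f g; rewrite -/(tau (star f g)) tau_star.
- split; first exact: star_medial.
  move=> f g h; rewrite associator_star //; split=> //.
  rewrite det_mx22 /omega -!mul_polyC !polyCM.
  by ring.
Qed.
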